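(* Let $m\ge 4$ be even, let $\tilde M=(\tilde m_{i,j})_{i,j\in[0,m-1]}$ be a magic square of side $m$ with magic constant $\tilde\mu$, and let $Q$ be the $2m\times 2m$ square over $D_{2m^2}$ built from $\tilde M$ with blocks $Q^{11},Q^{12},Q^{21},Q^{22}$ as described in the context. Then for all $i,j,c\in[0,m-1]$ the following hold. Row products: $$\rho^{11}_{i,0}\,\rho^{12}_{i,c}=\rho^{21}_{i,c}\,\rho^{22}_{i,0}=\begin{cases} r^{4\tilde\mu}, & c \text{ even},\\ r^{m}, & c\text{ odd};\end{cases}$$ column products: $$\sigma^{11}_{j,0}\,\sigma^{21}_{j,c}=\sigma^{12}_{j,c}\,\sigma^{22}_{j,0}=\begin{cases} r^{4\tilde\mu}, & c \text{ even},\\ r^{m}, & c\text{ odd}.\end{cases}$$ Consequently the single $D_{2m^2}$-semi-magic square $Q$ admits two distinct magic constants, $r^{4\tilde\mu}$ and $r^{m}$, depending on the order in which the products are taken.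
   Context: $[a,b]$ denotes the set of integers from $a$ to $b$. The dihedral group $D_k$ ($k\ge3$) has order $2k$ and elements $r^i$ (rotations) and $r^is$ (reflections), $0\le i\le k-1$, with $r^k=e$, $(r^is)^2=e$, $r^is=sr^{-i}$. A magic square of side $m$ is an $m\times m$ array containing each of $1,2,\dots,m^2$ exactly once such that every row, every column and both main diagonals have the same sum $\tilde\mu=m(m^2+1)/2$ (the magic constant). For a group $\Gamma$ of order $n^2$, a $\Gamma$-semi-magic square of side $n$ with magic constant $\mu\in\Gamma$ is an $n\times n$ array containing each element of $\Gamma$ exactly once such that for every row, and for every column, there is an ordering of its entries in which their product equals $\mu$. An element $\mu$ for which this holds is called a magic constant of the array; an array may have more than one. Construction of $Q$ for $m$ even. All row and column indices $i,j$ range over $[0,m-1]$ and are read modulo $m$; exponents of $r$ are read modulo $2m^2$. Put $e_{i,j}=2\tilde m_{i,j}$, $o_{i,j}=2\tilde m_{i,j}+1$, $t_{i,j}=-2\tilde m_{i,j}+1$ (all modulo $2m^2$). Define $m\times m$ arrays $Q^{uv}=(q^{uv}_{i,j})$, $u,v\in\{1,2\}$, by - $q^{11}_{i,j}=r^{e_{i,j}}$ if $i+j$ is even, and $r^{o_{i,j}}$ if $i+j$ is odd; - $q^{22}_{i,j}=r^{e_{i,j+1}}$ if $i+j$ is even, and $r^{o_{i,j+1}}$ if $i+j$ is odd; - $q^{12}_{i,j}=r^{e_{i,j}}s$ if $i+j$ is even, and $r^{t_{i,j}}s$ if $i+j$ is odd; - $q^{21}_{i,j}=r^{e_{i,j+1}}s$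 if $i+j$ is even, and $r^{t_{i,j+1}}s$ if $i+j$ is odd. The square $Q$ is the $2m\times 2m$ block array with $Q^{11}$ top left, $Q^{12}$ top right, $Q^{21}$ bottom left, $Q^{22}$ bottom right. For $c\in[0,m-1]$, define the products of all $m$ entries of a row or column of a block, taken in cyclic order (subscripts modulo $m$): $$\rho^{uv}_{i,c}=q^{uv}_{i,i+c}\,q^{uv}_{i,i+c+1}\cdots q^{uv}_{i,i+c-1},\qquad \sigma^{uv}_{j,c}=q^{uv}_{j-c,j}\,q^{uv}_{j-c-1,j}\cdots q^{uv}_{j-c+1,j}.$$ *)

(* Defs.v *)
From HB Require Import structures.
From mathcomp Require Import all_boot all_order all_algebra.
From mathcomp Require Import all_fingroup all_solvable.

Set Implicit Arguments.
Unset Strict Implicit.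
Unset Printing Implicit Defensive.

Import GroupScope.

(* The integer magic constant; the division is exact. *)
Definition magic_constant (m : nat) : nat := ((m * (m ^ 2 + 1)) %/ 2)%N.

Definition magic_square (m : nat) (M : 'M[nat]_m) : Prop :=
  (forall v : nat, (1 <= v <= m ^ 2)%N ->
     #|[set ij : 'I_m * 'I_m | M ij.1 ij.2 == v]| = 1%N) /\
  [/\ forall i : 'I_m, (\sum_(j < m) M i j)%N = magic_constant m,
      forall j : 'I_m, (\sum_(i < m) M i j)%N = magic_constant m,
      (\sum_(i < m) M i i)%N = magic_constant m
    & (\sum_(i < m) M i (rev_ord i))%N = magic_constant m].

(* An ordering of the entries of a line is a permutation of its indices;
   \prod in group_scope multiplies from left to right by increasing index. *)
Definition semi_magic_square (gT : finGroupType) (n : nat)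
    (A : 'M[gT]_n) (mu : gT) : Prop :=
  [/\ #|gT| = (n ^ 2)%N,
      forall g : gT, #|[set ij : 'I_n * 'I_n | A ij.1 ij.2 == g]| = 1%N,
      forall i : 'I_n, exists p : {perm 'I_n}, \prod_(j < n) A i (p j) = mu
    & forall j : 'I_n, exists p : {perm 'I_n}, \prod_(i < n) A (p i) j = mu].

(* The dihedral group D_k of order 2k is written 'D_(2 * k) below; the library
   names no rotation or reflection in it, so r and s are any pair of elements
   for which the usual description of D_k holds. *)
Definition dihedral_rs (k : nat) (r s : 'D_(2 * k)) : Prop :=
  [/\ forall g : 'D_(2 * k),
        exists2 i : nat, (i < k)%N & g = r ^+ i \/ g = r ^+ i * s,
      r ^+ k = 1,
      forall i : nat, (r ^+ i * s) ^+ 2 = 1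
    & forall i : nat, r ^+ i * s = s * r ^- i].

Lemma dihedral_rs_exists (k : nat) : (2 < k)%N ->
  exists r s : 'D_(2 * k), dihedral_rs r s.
Proof.
move=> k_gt2; have k_gt1 := ltnW k_gt2.
have /existsP[[r s] /= /eqP[defG rk s2 rs]] :
    'D_(2 * k) \homg Grp (x : y : x ^+ k, y ^+ 2, x ^ y = x^-1).
  by have /isoGrp_hom := @Grp_dihedral k k_gt1; rewrite -mul2n.
have sr i : r ^+ i * s = s * r ^- i.
  by rewrite -expgVn -rs -conjXg -conjgC.
exists r, s; split=> // [g | i]; last first.
  have ss : s * s = 1 by rewrite -s2 expgS expg1.
  by rewrite expgS expg1 [X in _ * X]sr -mulgA (mulgA s) ss mul1g mulgV.
have nsr : <[s]> \subset 'N(<[r]>).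
  by rewrite norms_cycle rs groupV cycle_id.
have: g \in <[r]> * <[s]> by rewrite -norm_joinEr // defG inE.
case/mulsgP=> _ _ /cycleP[i ->] /cycleP[j ->] ->.
exists (i %% k)%N; first by rewrite ltn_mod ltnW.
rewrite expg_mod // -(expg_mod j s2) modn2.
by case: (odd j); [right | left; rewrite mulg1].
Qed.

Section Construction.

Variables (gT : finGroupType) (r s : gT) (m : nat) (M : 'M[nat]_m).

(* r^(e_(i,j)), r^(o_(i,j)) and r^(t_(i,j)), where t_(i,j) = - 2 M_(i,j) + 1
   may be a negative exponent. *)
Definition re (i j : 'I_m) : gT := r ^+ (2 * M i j).
Definition ro (i j : 'I_m) : gT := r ^+ (2 * M i j + 1).
Definition rt (i j : 'I_m) : gT := r ^- (2 * M i j) * r.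

(* [ordS j] is j + 1 modulo m. *)
Definition Q11 : 'M[gT]_m :=
  \matrix_(i, j) (if odd (i + j) then ro i j else re i j).
Definition Q22 : 'M[gT]_m :=
  \matrix_(i, j) (if odd (i + j) then ro i (ordS j) else re i (ordS j)).
Definition Q12 : 'M[gT]_m :=
  \matrix_(i, j) (if odd (i + j) then rt i j * s else re i j * s).
Definition Q21 : 'M[gT]_m :=
  \matrix_(i, j)
    (if odd (i + j) then rt i (ordS j) * s else re i (ordS j) * s).

Definition Q : 'M[gT]_(m + m) := block_mx Q11 Q12 Q21 Q22.

End Construction.

(* Iterating [ordS] (resp. [ord_pred]) d times adds (resp. subtracts) d
   modulo m. *)
Definition rho (gT : finGroupType) (m : nat) (q : 'M[gT]_m)
    (i : 'I_m) (c : nat) : gT :=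
  \prod_(k < m) q i (iter (c + k) (@ordS m) i).
Definition sigma (gT : finGroupType) (m : nat) (q : 'M[gT]_m)
    (j : 'I_m) (c : nat) : gT :=
  \prod_(k < m) q (iter (c + k) (@ord_pred m) j) j.

(* Main.v *)
Require Import Defs.
From HB Require Import structures.
From mathcomp Require Import all_boot all_order all_algebra.
From mathcomp Require Import all_fingroup all_solvable.
From mathcomp Require Import zify.

Set Implicit Arguments.
Unset Strict Implicit.
Unset Printing Implicit Defensive.

Import GroupScope.

(* Along a line of a block the rotations commute and multiply to
   r^(2 mu + m/2), wherever the product starts.  Reflections pair up as
   (r^a s)(r^b s) = r^(a - b), so that exponents contribute with alternating
   signs; since the exponents are 2 M and -2 M + 1 alternately, moving the
   starting point by one step inverts the product, which is r^(2 mu - m/2) or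
   its inverse.  The two constants r^(4 mu) and r^m differ because r has order
   2 m^2 and 4 mu = 2 m modulo 2 m^2. *)

(** * Cyclic walks through the indices, and parity along them *)

Section CyclicWalks.

Variable m : nat.
Implicit Types (f : 'I_m -> 'I_m) (i j x : 'I_m).

Lemma val_iter_ordS d j : (iter d (@ordS m) j : nat) = ((j + d) %% m)%N.
Proof.
elim: d => [|d IHd] /=; first by rewrite addn0 modn_small.
by rewrite IHd -addn1 modnDml addn1 addnS.
Qed.

Lemma iter_ordS_fix d j : iter d (@ordS m) j = j -> (m %| d)%N.
Proof.
move/(congr1 (@nat_of_ord m)); rewrite val_iter_ordS => Ejd.
have /eqP: j + d = j + 0 %[mod m] by rewrite Ejd addn0 modn_small.
by rewrite eqn_modDl mod0n.
Qed.

Lemma iter_ord_pred_fix d j : iter d (@ord_pred m) j = j -> (m %| d)%N.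
Proof.
move=> Ejd; apply: (@iter_ordS_fix d j); rewrite -{1}Ejd.
elim: d {Ejd} => //= d IHd; rewrite -iterS iterSr ord_predK; exact: IHd.
Qed.

(** If steps [k <= l] reach the same index, cancelling the common [c + k] steps leaves [l - k] steps
    fixing [x]; this number is below [m] and divisible by [m], hence zero. So every walk visits a
    whole line once. *)
Lemma iter_walk_inj f c x :
    injective f -> (forall d j, iter d f j = j -> (m %| d)%N) ->
  injective (fun k : 'I_m => iter (c + k) f x).
Proof.
move=> injf fixf k l Ekl; apply: val_inj => /=.
wlog le_kl: k l Ekl / (k <= l)%N.
  by move=> IH; case/orP: (leq_total k l) => /IH-> //; exact: esym.
have: iter (l - k) f x = x.
  have injfn n: injective (iter n f).
    by elim: n => //= n IHn y z /injf/IHn.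
  apply: (injfn (c + k)%N); rewrite -iterD Ekl.
  by congr iter; lia.
move/fixf/dvdn_leq; have := ltn_ord l; lia.
Qed.

Lemma walkS_inj c x : injective (fun k : 'I_m => iter (c + k) (@ordS m) x).
Proof. exact: iter_walk_inj (@ordS_inj m) iter_ordS_fix. Qed.

Lemma walk_pred_inj c x :
  injective (fun k : 'I_m => iter (c + k) (@ord_pred m) x).
Proof. exact: iter_walk_inj (@ord_pred_inj m) iter_ord_pred_fix. Qed.

Hypothesis m_even : ~~ odd m.

(** Evenness of [m] lets parity alternate also across the wraparound from [m - 1] to 0. *)
Lemma odd_ordS j : odd (ordS j) = ~~ odd j.
Proof. by rewrite /= odd_mod ?(negPf m_even). Qed.

Lemma odd_ord_pred j : odd (ord_pred j) = ~~ odd j.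
Proof. by rewrite -{2}[j]ord_predK odd_ordS negbK. Qed.

Lemma odd_iter_ordS d j : odd (iter d (@ordS m) j) = odd (d + j).
Proof. by elim: d => // d IHd; rewrite iterS odd_ordS IHd. Qed.

Lemma odd_iter_ord_pred d j : odd (iter d (@ord_pred m) j) = odd (d + j).
Proof. by elim: d => // d IHd; rewrite iterS odd_ord_pred IHd. Qed.

End CyclicWalks.

(** * Alternating products of rotations and of reflections *)

Section AlternatingProducts.

Variables (gT : finGroupType) (r s : gT).
Hypotheses (ss : s * s = 1) (rs : r ^ s = r^-1).

Lemma prod_rotations (E : nat -> nat) n :
  \prod_(k < n.*2) (if odd k then r ^+ (2 * E k + 1) else r ^+ (2 * E k))
    = r ^+ (2 * (\sum_(k < n.*2) E k) + n).
Proof.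
elim: n => [|n IHn]; first by rewrite !big_ord0.
rewrite doubleS !big_ord_recr /= IHn odd_double /= -!expgD.
by congr (r ^+ _); lia.
Qed.

(** A power of [r] with integer exponent [a - b], kept as a pair of naturals so that exponent
    identities become linear arithmetic. *)
Let D a b := r ^+ a * r ^- b.

Let rC k l : r ^- k * r ^+ l = r ^+ l * r ^- k.
Proof. exact/commute_sym/commuteV/commuteX2/commute_refl. Qed.

Let D_mul a b c d : D a b * D c d = D (a + c) (b + d).
Proof.
by rewrite /D mulgA -(mulgA (r ^+ a)) rC mulgA -expgD -mulgA -invMg -expgD (addnC d).
Qed.

Let D_reflections a b c d : D a b * s * (D c d * s) = D (a + d) (b + c).
Proof.
have sV: s^-1 = s by apply/eqP; rewrite eq_invg_mul ss.
have -> : D a b * s * (D c d * s) = D a b * (D c d) ^ s.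
  by rewrite conjgE sV !mulgA.
rewrite /D conjMg conjVg !conjXg rs !expgVn invgK -/(D a b).
by rewrite rC D_mul.
Qed.

(** Induction by pairs. For [c] even a pair has exponent [2 E k - (1 - 2 E (k+1))], so both entries
    count positively and 1 is lost; for [c] odd the exponent is the negative of this. *)
Lemma prod_reflections (E : nat -> nat) c n :
  \prod_(k < n.*2) (if odd (c + k) then r ^- (2 * E k) * r * s
                    else r ^+ (2 * E k) * s)
    = let e := (2 * \sum_(k < n.*2) E k)%N in
      if odd c then r ^+ n * r ^- e else r ^+ e * r ^- n.
Proof.
have eD k : r ^+ k = D k 0 by rewrite /D invg1 mulg1.
have tD k : r ^- k * r = D 1 k by rewrite -[X in _ * X]expg1 rC.
elim: n => [|n IHn].
  by rewrite !big_ord0 /= invg1 mulg1 if_same.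
rewrite doubleS !big_ord_recr /= IHn addnS /= oddD odd_double addbF.
rewrite -mulgA -!/(D _ _); case: (odd c) => /=;
  by rewrite !tD !eD D_reflections D_mul; congr (D _ _); lia.
Qed.

End AlternatingProducts.

(** * Row and column products of [Q] *)

Section Lines.

Variables (gT : finGroupType) (r s : gT) (m : nat) (M : 'M[nat]_m).
Hypotheses (ss : s * s = 1) (rs : r ^ s = r^-1) (m_even : ~~ odd m).

(** The exponent [2 mu + m/2] of the rotations meets [2 mu - m/2] or its negative, giving [4 mu] or
    [m]. Both orders are needed, since the rotation block comes first in some lines and last in
    others; [E] and [E'] differ because the two blocks may be walked from different starts or read
    different columns of [M]. *)
Lemma prod_line (E E' : nat -> nat) mu c :
    (\sum_(k < m) E k = mu)%N -> (\sum_(k < m) E' k = mu)%N ->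
  let rot := \prod_(k < m) (if odd k then r ^+ (2 * E k + 1)
                            else r ^+ (2 * E k)) in
  let refl := \prod_(k < m) (if odd (c + k) then r ^- (2 * E' k) * r * s
                             else r ^+ (2 * E' k) * s) in
  let res := if odd c then r ^+ m else r ^+ (4 * mu) in
  rot * refl = res /\ refl * rot = res.
Proof.
move=> sumE sumE' rot refl res.
have Erot : rot = r ^+ (2 * mu + m./2).
  by have := prod_rotations r E m./2; rewrite even_halfK // sumE.
have Erefl : refl = if odd c then r ^+ m./2 * r ^- (2 * mu)
                    else r ^+ (2 * mu) * r ^- m./2.
  by have := prod_reflections ss rs E' c m./2; rewrite even_halfK //= sumE'.
have rC a b : commute (r ^+ a) (r ^+ b).
  exact/commuteX2/commute_refl.
(* An even number of reflections multiplies to a rotation, so the two factors commute. *)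
have refl_rot : refl * rot = rot * refl.
  rewrite Erefl Erot; case: ifP => _; apply: commute_sym; apply: commuteM;
    rewrite ?commuteV //; first [exact: rC | exact/commuteV/rC].
rewrite refl_rot; suff -> : rot * refl = res by [].
rewrite Erefl Erot /res; case: ifP => _; rewrite mulgA -expgD;
  apply: (canLR (mulgK _)); rewrite -expgD; congr (r ^+ _); lia.
Qed.

Hypothesis row_sum : forall i, (\sum_(j < m) M i j)%N = magic_constant m.
Hypothesis col_sum : forall j, (\sum_(i < m) M i j)%N = magic_constant m.

Let res (c : nat) := if odd c then r ^+ m else r ^+ (4 * magic_constant m).

Lemma row_walk_sum i (g : 'I_m -> 'I_m) :
  injective g -> (\sum_(k < m) M i (g k))%N = magic_constant m.
Proof. by move=> g_inj; rewrite -(row_sum i) [RHS](reindex_inj g_inj). Qed.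

Lemma col_walk_sum j (g : 'I_m -> 'I_m) :
  injective g -> (\sum_(k < m) M (g k) j)%N = magic_constant m.
Proof. by move=> g_inj; rewrite -(col_sum j) [RHS](reindex_inj g_inj). Qed.

(** Since the walk in row [i] starts at column [i], the parity test in the blocks sees only the
    number of steps. *)
Let odd_row (i : 'I_m) d : odd (i + iter d (@ordS m) i) = odd d.
Proof. by rewrite oddD odd_iter_ordS // oddD addbCA addbb addbF. Qed.

Let odd_col (j : 'I_m) d : odd (iter d (@ord_pred m) j + j) = odd d.
Proof. by rewrite oddD odd_iter_ord_pred // oddD -addbA addbb addbF. Qed.

Lemma row_products (i : 'I_m) c :
  rho (Q11 r M) i 0 * rho (Q12 r s M) i c = res c /\
  rho (Q21 r s M) i c * rho (Q22 r M) i 0 = res c.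
Proof.
have [Htop _] := @prod_line (fun k => M i (iter (0 + k) (@ordS m) i))
  (fun k => M i (iter (c + k) (@ordS m) i)) _ c
  (row_walk_sum i (@walkS_inj m 0 i))
  (row_walk_sum i (@walkS_inj m c i)).
(* The bottom blocks read [M] one column further right, hence the extra [ordS]. *)
have [_ Hbot] := @prod_line (fun k => M i (ordS (iter (0 + k) (@ordS m) i)))
  (fun k => M i (ordS (iter (c + k) (@ordS m) i))) _ c
  (row_walk_sum i (inj_comp (@ordS_inj m) (@walkS_inj m 0 i)))
  (row_walk_sum i (inj_comp (@ordS_inj m) (@walkS_inj m c i))).
split; [rewrite -[RHS]Htop | rewrite -[RHS]Hbot];
  by congr (_ * _); apply: eq_bigr => k _; rewrite mxE odd_row.
Qed.

Lemma column_products (j : 'I_m) c :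
  sigma (Q11 r M) j 0 * sigma (Q21 r s M) j c = res c /\
  sigma (Q12 r s M) j c * sigma (Q22 r M) j 0 = res c.
Proof.
(* Column [j] of [Q21] or [Q22] is filled from column [ordS j] of [M], so the two sums run over
   neighbouring columns. *)
have [H1 _] := @prod_line (fun k => M (iter (0 + k) (@ord_pred m) j) j)
  (fun k => M (iter (c + k) (@ord_pred m) j) (ordS j)) _ c
  (col_walk_sum j (@walk_pred_inj m 0 j))
  (col_walk_sum (ordS j) (@walk_pred_inj m c j)).
have [_ H2] :=
  @prod_line (fun k => M (iter (0 + k) (@ord_pred m) j) (ordS j))
  (fun k => M (iter (c + k) (@ord_pred m) j) j) _ c
  (col_walk_sum (ordS j) (@walk_pred_inj m 0 j))
  (col_walk_sum j (@walk_pred_inj m c j)).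
split; [rewrite -[RHS]H1 | rewrite -[RHS]H2];
  by congr (_ * _); apply: eq_bigr => k _; rewrite mxE odd_col.
Qed.

End Lines.

(** * Orderings of full lines of [Q], and occurrence of every group element *)

Lemma split_perm_exists n (a b : 'I_n -> 'I_n) :
    injective a -> injective b ->
  exists p : {perm 'I_(n + n)},
    (forall k, p (lshift n k) = lshift n (a k)) /\
    (forall k, p (rshift n k) = rshift n (b k)).
Proof.
move=> a_inj b_inj.
pose f (x : 'I_(n + n)) :=
  match split x with inl k => lshift n (a k) | inr k => rshift n (b k) end.
have fl k : f (lshift n k) = lshift n (a k) by rewrite /f (unsplitK (inl k)).
have fr k : f (rshift n k) = rshift n (b k) by rewrite /f (unsplitK (inr k)).
have f_inj : injective f.
  move=> x y; case: (split_ordP x) => k ->; case: (split_ordP y) => l ->;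
    rewrite ?fl ?fr => /eqP; rewrite ?eq_shift // => /eqP.
  - by move/a_inj->.
  - by move/b_inj->.
by exists (perm f_inj); split=> k; rewrite permE.
Qed.

Section SemiMagic.

Variables (gT : finGroupType) (r s : gT) (m : nat) (M : 'M[nat]_m).
Let A := Q r s M.

(** The ordering walks through the left half, then the right half, so its product splits into the
    two block products. The shift [c] always goes to the block of reflections. *)
Lemma row_ordering (i : 'I_(m + m)) mu c :
    (forall i, rho (Q11 r M) i 0 * rho (Q12 r s M) i c = mu /\
               rho (Q21 r s M) i c * rho (Q22 r M) i 0 = mu) ->
  exists p : {perm 'I_(m + m)}, \prod_j A i (p j) = mu.
Proof.
move=> Hrho; case: (split_ordP i) => k ->; have [Htop Hbot] := Hrho k.
  have [p [pl pr]] := split_perm_exists (@walkS_inj m 0 k) (@walkS_inj m c k).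
  exists p; rewrite -[RHS]Htop big_split_ord; congr (_ * _);
    apply: eq_bigr => j _; rewrite ?pl ?pr ?block_mxEul ?block_mxEur //.
have [p [pl pr]] := split_perm_exists (@walkS_inj m c k) (@walkS_inj m 0 k).
exists p; rewrite -[RHS]Hbot big_split_ord; congr (_ * _);
  apply: eq_bigr => j _; rewrite ?pl ?pr ?block_mxEdl ?block_mxEdr //.
Qed.

Lemma column_ordering (j : 'I_(m + m)) mu c :
    (forall j, sigma (Q11 r M) j 0 * sigma (Q21 r s M) j c = mu /\
               sigma (Q12 r s M) j c * sigma (Q22 r M) j 0 = mu) ->
  exists p : {perm 'I_(m + m)}, \prod_i A (p i) j = mu.
Proof.
move=> Hsigma; case: (split_ordP j) => k ->; have [Hl Hr] := Hsigma k.
  have [p [pl pr]] :=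
    split_perm_exists (@walk_pred_inj m 0 k) (@walk_pred_inj m c k).
  exists p; rewrite -[RHS]Hl big_split_ord; congr (_ * _);
    apply: eq_bigr => i _; rewrite ?pl ?pr ?block_mxEul ?block_mxEdl //.
have [p [pl pr]] :=
  split_perm_exists (@walk_pred_inj m c k) (@walk_pred_inj m 0 k).
exists p; rewrite -[RHS]Hr big_split_ord; congr (_ * _);
  apply: eq_bigr => i _; rewrite ?pl ?pr ?block_mxEur ?block_mxEdr //.
Qed.

Hypothesis m_even : ~~ odd m.
Hypothesis m_gt0 : (0 < m)%N.
Hypothesis M_onto : forall v, (1 <= v <= m ^ 2)%N -> exists i j, M i j = v.
Hypothesis rk : r ^+ (2 * m ^ 2) = 1.

Lemma even_exponent a :
  exists2 v, (1 <= v <= m ^ 2)%N & r ^+ (2 * a) = r ^+ (2 * v).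
Proof.
have m2_gt0 : (0 < m ^ 2)%N by rewrite expn_gt0 m_gt0.
(* The residue of [a] modulo [m ^ 2] taken in [[1, m ^ 2]], the range of the entries of [M], instead
   of from 0. *)
exists ((a + (m ^ 2).-1) %% m ^ 2).+1; first by rewrite /= ltn_mod.
rewrite -[LHS]mulg1 -{1}rk -expgD -mulnDr.
have -> : (a + m ^ 2 = (a + (m ^ 2).-1) %/ m ^ 2 * m ^ 2 +
                       ((a + (m ^ 2).-1) %% m ^ 2).+1)%N.
  by have := divn_eq (a + (m ^ 2).-1) (m ^ 2); lia.
by rewrite mulnDr expgD mulnCA mulnC expgM rk expg1n mul1g.
Qed.

(** Serves the odd reflections, in which the entries of [M] occur with negative sign. *)
Lemma even_exponentV a :
  exists2 v, (1 <= v <= m ^ 2)%N & r ^+ (2 * a) = r ^- (2 * v).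
Proof.
have m2_gt0 : (0 < m ^ 2)%N by rewrite expn_gt0 m_gt0.
(* [a * (m ^ 2 - 1)] is a natural number congruent to [- a] modulo [m ^ 2]. *)
have [v v_m2 Ev] := even_exponent (a * (m ^ 2).-1); exists v => //.
apply/eqP; rewrite eq_sym eq_invg_mul -Ev -expgD -mulnDr -mulnSr prednK //.
by rewrite mulnCA mulnC expgM rk expg1n.
Qed.

(* Cell (i, j) of the magic square is read in a top block at column j and in
   the bottom block on the other diagonal at column j - 1; exactly one of the
   two carries an odd exponent, according to the parity of i + j. *)
Lemma rotation_in_Q a : exists i j, A i j = r ^+ a.
Proof.
have [v /M_onto[i [j <-]] Ev] := even_exponent a./2.
have -> : r ^+ a = if odd a then ro r M i j else re r M i j.
  rewrite -{1}(odd_double_half a) -mul2n expgD Ev /ro /re -expgD addnC.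
  by case: (odd a); rewrite ?addn0.
have oddp : odd (i + ord_pred j) = ~~ odd (i + j).
  by rewrite !oddD odd_ord_pred // addbN.
have [Eo | /negPf Eo] := eqVneq (odd (i + j)) (odd a).
  by exists (lshift m i), (lshift m j); rewrite block_mxEul mxE Eo.
exists (rshift m i), (rshift m (ord_pred j)); rewrite block_mxEdr mxE oddp.
by rewrite ord_predK; move: Eo; case: (odd _); case: (odd a).
Qed.

Lemma reflection_in_Q a : exists i j, A i j = r ^+ a * s.
Proof.
have [v [/M_onto[i [j <-]] Ev]] : exists v, (1 <= v <= m ^ 2)%N /\
    r ^+ a = if odd a then r ^- (2 * v) * r else r ^+ (2 * v).
  rewrite -{1}(odd_double_half a) -mul2n addnC expgD; case: (odd a).
    by have [v v_m2 Ev] := even_exponentV a./2; exists v; rewrite Ev.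
  by have [v v_m2 Ev] := even_exponent a./2; exists v; rewrite Ev mulg1.
have oddp : odd (i + ord_pred j) = ~~ odd (i + j).
  by rewrite !oddD odd_ord_pred // addbN.
have -> : r ^+ a * s = if odd a then rt r M i j * s else re r M i j * s.
  by rewrite Ev; case: (odd a).
have [Eo | /negPf Eo] := eqVneq (odd (i + j)) (odd a).
  by exists (lshift m i), (rshift m j); rewrite block_mxEur mxE Eo.
exists (rshift m i), (lshift m (ord_pred j)); rewrite block_mxEdl mxE oddp.
by rewrite ord_predK; move: Eo; case: (odd _); case: (odd a).
Qed.

End SemiMagic.

(** A surjection between finite sets of equal size is injective; thus occurring exactly once reduces
    to occurring at all. *)
Lemma surjective_fiber_card (I T : finType) (f : I -> T) :
    #|I| = #|T| -> (forall y, exists x, f x = y) ->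
  forall y, #|[set x | f x == y]| = 1%N.
Proof.
move=> eqIT f_onto y.
have f_inj : {in predT &, injective f}.
  apply/imset_injP; rewrite eqIT; apply/eqP/eq_card => z.
  by have [x <-] := f_onto z; rewrite inE imset_f.
have [x fx] := f_onto y; rewrite -[RHS](cards1 x); apply: eq_card => z.
rewrite !inE -fx; apply/eqP/eqP => [|-> //]; exact: f_inj.
Qed.

(** * Dihedral relations and the order of [r] *)

Lemma dihedral_rs_relations k (r s : 'D_(2 * k)) :
  dihedral_rs r s -> s * s = 1 /\ r ^ s = r^-1.
Proof.
case=> _ _ s2 sr; split; first by have := s2 0; rewrite mul1g expgS expg1.
by have := sr 1%N; rewrite expg1 conjgE => ->; rewrite mulKg.
Qed.

Lemma card_dihedral_type k : (1 < k)%N -> #|{: 'D_(2 * k)}| = (2 * k)%N.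
Proof. by move=> k_gt1; rewrite -cardsT mul2n card_dihedral. Qed.

(** The relation [r ^+ k = 1] bounds the order above. Below, the [2 * k] elements of the group all
    lie in [<[r]>] and its coset by [s], which together hold at most [2 * #[r]]. *)
Lemma dihedral_rs_order k (r s : 'D_(2 * k)) :
  (1 < k)%N -> dihedral_rs r s -> #[r] = k.
Proof.
move=> k_gt1 [g_form rk _ _]; apply/eqP; rewrite eqn_leq.
rewrite dvdn_leq ?order_dvdn ?rk ?(ltnW k_gt1) //=.
rewrite -(leq_pmul2l (m := 2)) //.
have sub : 'D_(2 * k) \subset <[r]> :|: <[r]> :* s.
  apply/subsetP=> g _; have [i _ [->|->]] := g_form g; rewrite inE.
    by rewrite mem_cycle.
  by rewrite mem_rcoset mulgK mem_cycle orbT.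
have := subset_leq_card sub; rewrite cardsT card_dihedral_type //.
move/leq_trans; apply.
apply: leq_trans (leq_card_setU _ _) _.
by rewrite card_rcoset addnn -orderE -(mul2n #[r]).
Qed.

Theorem mainTheorem2 (m : nat) (M : 'M[nat]_m) (r s : 'D_(2 * (2 * m ^ 2)))
    (hm : (4 <= m)%N) (m_even : ~~ odd m) (hM : magic_square M)
    (hrs : dihedral_rs r s) :
  [/\ forall i c : 'I_m,
        rho (Q11 r M) i 0 * rho (Q12 r s M) i c
          = (if odd c then r ^+ m else r ^+ (4 * magic_constant m)) /\
        rho (Q21 r s M) i c * rho (Q22 r M) i 0
          = (if odd c then r ^+ m else r ^+ (4 * magic_constant m)),
      forall j c : 'I_m,
        sigma (Q11 r M) j 0 * sigma (Q21 r s M) j c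
          = (if odd c then r ^+ m else r ^+ (4 * magic_constant m)) /\
        sigma (Q12 r s M) j c * sigma (Q22 r M) j 0
          = (if odd c then r ^+ m else r ^+ (4 * magic_constant m))
    & [/\ semi_magic_square (Q r s M) (r ^+ (4 * magic_constant m)),
          semi_magic_square (Q r s M) (r ^+ m)
        & r ^+ (4 * magic_constant m) <> r ^+ m]].
Proof.
have [ss rs] := dihedral_rs_relations hrs.
have k_gt1 : (1 < 2 * m ^ 2)%N by nia.
have r_order := dihedral_rs_order k_gt1 hrs.
have [g_form rk _ _] := hrs.
have [M_cells [row_sum col_sum _ _]] := hM.
have M_onto v : (1 <= v <= m ^ 2)%N -> exists i j, M i j = v.
  move/M_cells/eqP/cards1P=> [[i j]] /setP/(_ (i, j)).
  by rewrite !inE eqxx => /eqP <-; exists i, j.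
have rows := row_products ss rs m_even row_sum.
have cols := column_products ss rs m_even col_sum.
have cardT := card_dihedral_type k_gt1.
have Q_once g : #|[set ij | Q r s M ij.1 ij.2 == g]| = 1%N.
  apply: surjective_fiber_card => [|{}g].
    by rewrite card_prod card_ord cardT; lia.
  have m_gt0 : (0 < m)%N by apply: leq_trans hm.
  have [a _ [->|->]] := g_form g.
    by have [i [j Eij]] := rotation_in_Q s m_even m_gt0 M_onto rk a; exists (i, j).
  by have [i [j Eij]] := reflection_in_Q s m_even m_gt0 M_onto rk a; exists (i, j).
split=> [i c | j c |]; [exact: rows | exact: cols | split].
(* The shift 0 realises the constant for even [c]; the shift 1, below, the one for odd [c]. *)
- split=> [|//|i|j]; first by rewrite cardT; lia.
    by apply: (@row_ordering _ _ _ _ _ _ _ 0) => k; apply: rows.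
  by apply: (@column_ordering _ _ _ _ _ _ _ 0) => k; apply: cols.
- split=> [|//|i|j]; first by rewrite cardT; lia.
    by apply: (@row_ordering _ _ _ _ _ _ _ 1%N) => k; apply: rows.
  by apply: (@column_ordering _ _ _ _ _ _ _ 1%N) => k; apply: cols.
(* Dropping the multiple of [2 * m ^ 2], equality of the constants would read
   [r ^+ m * r ^+ m = r ^+ m]; then [2 * m ^ 2], the order of [r], would divide the smaller positive
   number [m]. *)
have mu4 : (4 * magic_constant m = 2 * m ^ 2 * m + m + m)%N.
  rewrite /magic_constant; have [q ->] : exists q, m = (2 * q)%N.
    by exists m./2; rewrite mul2n even_halfK.
  by rewrite -mulnA mulKn //; lia.
rewrite mu4 2!expgD expgM rk expg1n mul1g => /eqP.
by rewrite eq_mulgV1 mulgK -order_dvdn r_order => /dvdn_leq; nia.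
Qed.
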